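(* Let $H$ be a complex, separable, infinite-dimensional Hilbert space, let $T\in B(H)$ be a normal operator and let $\varphi\in H$ be such that $\{T^n\varphi\}_{n\ge0}$ is a frame for $H$. Then $\{T^n\varphi\}_{n\ge0}$ is not a Riesz frame.
   Context: A family $\{f_n\}_{n\in I}$ ($I$ countable) in $H$ is a frame for $H$ if there are constants $0<C_1\le C_2$ with $C_1\|f\|^2\le\sum_{n\in I}|\langle f,f_n\rangle|^2\le C_2\|f\|^2$ for all $f\in H$; it is a frame sequence if it is a frame for its closed linear span. A frame $\{f_n\}_{n\in I}$ is a Riesz frame if there are constants $0<C_1\le C_2$ such that for every $J\subset I$ the family $\{f_n\}_{n\in J}$ is a frame sequence with frame bounds $C_1,C_2$. $B(H)$ denotes the bounded linear operators on $H$. *)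

(* Defs.v *)
From HB Require Import structures.
From mathcomp Require Import all_boot all_order all_algebra.
From mathcomp Require Import complex.
From mathcomp Require Import all_classical all_reals all_analysis.

Set Implicit Arguments.
Unset Strict Implicit.
Unset Printing Implicit Defensive.
Import Order.TTheory GRing.Theory Num.Theory.
Import numFieldNormedType.Exports.
Local Open Scope classical_set_scope.
Local Open Scope ring_scope.
Local Open Scope complex_scope.

(* Norms over R[i] take their values in R[i], on its nonnegative real
   half-line; this is the same norm as an element of R. *)
Definition rnorm (R : realType) (V : normedZmodType R[i]) (x : V) : R :=
  complex.Re `|x|.

Section HilbertSpace.
Context {R : realType} {H : completeNormedModType R[i]}.

(* Forms of type {dot H for conjC} are linear in the first argument and
   conjugate-linear in the second. *)
Definition dot_induces_norm (dot : {dot H for Num.conj}) : Prop :=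
  forall x : H, `|x| ^+ 2 = dot x x.

Definition separable : Prop := exists2 A : set H, countable A & dense A.

Definition linear_span (A : set H) : set H :=
  [set x | exists (n : nat) (c : 'I_n -> R[i]) (v : 'I_n -> H),
     (forall i, A (v i)) /\ x = \sum_(i < n) c i *: v i].

Definition infinite_dimensional : Prop :=
  ~ exists2 A : set H, finite_set A & linear_span A = [set: H].

Definition bounded_operator (T : {linear H -> H}) : Prop :=
  exists M : R, forall x : H, rnorm (T x) <= M * rnorm x.

(* When T is bounded, the Riesz representation theorem provides exactly one
   such z for each y, so that the default value 0 is never used. *)
Definition adjoint (dot : {dot H for Num.conj}) (T : H -> H) (y : H) : H :=
  xget 0 [set z | forall x : H, dot (T x) y = dot x z].

Definition normal_operator (dot : {dot H for Num.conj}) (T : H -> H) : Prop :=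
  forall x : H, T (adjoint dot T x) = adjoint dot T (T x).

Section Frames.
Context (dot : {dot H for Num.conj}) {I : countType}.
Implicit Types (e : I -> H) (J : set I) (K : set H).

(* The subfamily (e n), n in J, is a frame with bounds C1, C2 for the closed
   subspace K, its members being assumed to lie in K. *)
Definition frame_for_with_bounds e J K (C1 C2 : R) : Prop :=
  0 < C1 <= C2 /\
  forall f : H, K f ->
    ((C1 * rnorm f ^+ 2)%:E <= \esum_(n in J) (rnorm (dot f (e n)) ^+ 2)%:E
      /\ \esum_(n in J) (rnorm (dot f (e n)) ^+ 2)%:E
           <= (C2 * rnorm f ^+ 2)%:E)%E.

Definition is_frame e : Prop :=
  exists C1 C2 : R, frame_for_with_bounds e [set: I] [set: H] C1 C2.

Definition frame_sequence_with_bounds e J (C1 C2 : R) : Prop :=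
  frame_for_with_bounds e J (closure (linear_span (e @` J))) C1 C2.

Definition is_Riesz_frame e : Prop :=
  is_frame e /\
  exists C1 C2 : R, 0 < C1 <= C2 /\
    forall J : set I, frame_sequence_with_bounds e J C1 C2.

End Frames.
End HilbertSpace.

Arguments separable {R} H.
Arguments infinite_dimensional {R} H.

(* Main.v *)
Require Import Defs.
From HB Require Import structures.
From mathcomp Require Import all_boot all_order all_algebra.
From mathcomp Require Import complex.
From mathcomp Require Import all_classical all_reals all_analysis.
From mathcomp Require Import ring lra.
Import Order.TTheory GRing.Theory Num.Theory.
Import numFieldNormedType.Exports.
Local Open Scope classical_set_scope.
Local Open Scope ring_scope.
Local Open Scope complex_scope.

Set Implicit Arguments.
Unset Strict Implicit.

(** A member of a Riesz frame is either zero or not too small: the lower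
    frame inequality of the one-element subfamily [{e}], tested on [e] itself,
    reads [C1 |e|^2 <= |e|^4], that is, [C1 <= |e|^2] when [e <> 0]
    ([Riesz_frame_member_ge]).  An orbit [T^n phi] under a normal operator
    that is a frame violates this, because it tends to zero without ever
    reaching it.

    It has arbitrarily small members ([frame_orbit_small]): applied to
    [(T^* )^m f], the lower frame inequality gives
    [C1 |(T^* )^m f|^2 <= sum_n |<(T^* )^m f, T^n phi>|^2
                        = sum_(n >= m) |<f, T^n phi>|^2],
    and the right-hand side is the tail of a series that converges by the
    upper frame inequality.  So [(T^* )^m f -> 0] for every [f], and
    [|T^m f| = |(T^* )^m f|] as [T] is normal.

    It does not vanish: the kernels of the positive powers of a normal operator
    all coincide with the kernel of [T] ([iter_eq0]), so [T^m phi = 0] forces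
    [T phi = 0].  The frame then has at most one nonzero member,
    and [phi] alone spans [H] ([frame_orbit_ker]), contrary to the infinite
    dimension.

    Normality speaks of the adjoint, whose existence is the Riesz
    representation theorem ([Riesz_representation]).  Here completeness
    enters: approximate minimizers of [|x|^2 - 2 Re (l x)] represent [l] up to
    a small error in norm, hence form a Cauchy sequence, and their limit
    represents [l] exactly. *)

(** * The real-valued norm *)

Section RealNorm.
Context {R : realType} {V : normedZmodType R[i]}.
Implicit Types x y : V.

Lemma normE_rnorm x : `|x| = (rnorm x)%:C.
Proof. by rewrite /rnorm RRe_real // normr_real. Qed.

Lemma rnorm_ge0 x : 0 <= rnorm x.
Proof. by rewrite -lecR -normE_rnorm normr_ge0. Qed.

Lemma rnorm_eq0 x : rnorm x = 0 -> x = 0.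
Proof. by move=> x0; apply/normr0_eq0; rewrite normE_rnorm x0. Qed.

Lemma rnormD x y : rnorm (x + y) <= rnorm x + rnorm y.
Proof. by rewrite -lecR rmorphD /= -!normE_rnorm ler_normD. Qed.

Lemma rnormN x : rnorm (- x) = rnorm x.
Proof. by rewrite /rnorm normrN. Qed.

End RealNorm.

Lemma rnorm_sqr_conj (R : realType) (a : R[i]) :
  (rnorm a ^+ 2)%:C = a * Num.conj a.
Proof. by rewrite rmorphXn /= -normE_rnorm normCK. Qed.

Lemma rnorm_conj (R : realType) (a : R[i]) : rnorm (Num.conj a) = rnorm a.
Proof. by rewrite /rnorm norm_conjC. Qed.

Lemma rnorm_real (R : realType) (a : R) : rnorm a%:C = `|a|.
Proof. by rewrite /rnorm normc_def /= expr0n /= addr0 sqrtr_sqr. Qed.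

Lemma rnormM (R : realType) (a b : R[i]) : rnorm (a * b) = rnorm a * rnorm b.
Proof. by apply: complexI; rewrite rmorphM /= -!normE_rnorm normrM. Qed.

Lemma Re_le_rnorm (R : realType) (a : R[i]) : complex.Re a <= rnorm a.
Proof.
rewrite /rnorm normc_def /=; case: a => x y /=.
by rewrite (le_trans (ler_norm x)) // -sqrtr_sqr ler_wsqrtr // lerDl sqr_ge0.
Qed.

(** The discriminant inequality for a sesquilinear perturbation: the best
    choice of [a] is [conj w / N].  It yields both the Cauchy-Schwarz inequality
    and the error estimate of approximate minimizers in the Riesz
    representation theorem. *)
Lemma sqr_rnorm_le_of_quadratic (R : realType) (w : R[i]) (e N : R) :
  0 <= N ->
  (forall a : R[i], 2 * complex.Re (a * w) <= e + rnorm a ^+ 2 * N) ->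
  rnorm w ^+ 2 <= e * N.
Proof.
move=> N0 H.
(* It is enough to test on the real multiples of the conjugate of w. *)
have {}H (t : R) : 2 * (t * rnorm w ^+ 2) <= e + t ^+ 2 * rnorm w ^+ 2 * N.
  have /= := H (t%:C * Num.conj w).
  rewrite -mulrA [Num.conj w * w]mulrC -rnorm_sqr_conj -rmorphM /=.
  suff -> : rnorm (t%:C * Num.conj w) ^+ 2 = t ^+ 2 * rnorm w ^+ 2 by [].
  by rewrite rnormM exprMn rnorm_conj rnorm_real real_normK ?num_real.
have w0 := sqr_ge0 (rnorm w).
move: N0; rewrite le_eqVlt => /predU1P[N0|N0].
  rewrite -N0 mulr0 leNgt; apply/negP => wp.
  (* Without a quadratic term, this multiple makes the linear one exceed e. *)
  have := H ((e + 1) / rnorm w ^+ 2).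
  rewrite -N0 mulr0 divfK ?gt_eqF// addr0.
  have := H 0; rewrite expr0n /= !mul0r mulr0; lra.
have := H N^-1.
have -> : N^-1 ^+ 2 * rnorm w ^+ 2 * N = N^-1 * rnorm w ^+ 2.
  by field; rewrite gt_eqF.
move=> h; rewrite -ler_pdivrMr// mulrC; lra.
Qed.

(** * Hilbert spaces and the Riesz representation theorem *)

Section Hilbert.
Context {R : realType} {H : completeNormedModType R[i]}.
Context (dot : {dot H for Num.conj}) (dot_norm : dot_induces_norm dot).
Implicit Types (x y v : H) (T : {linear H -> H}).

Lemma dotC x y : dot x y = Num.conj (dot y x).
Proof. by rewrite (hermC dot x y) expr0 mul1r. Qed.

Lemma dotxx x : dot x x = (rnorm x ^+ 2)%:C.
Proof. by rewrite -dot_norm normE_rnorm rmorphXn. Qed.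

Lemma rnormZ (a : R[i]) x : rnorm (a *: x) = rnorm a * rnorm x.
Proof. by apply: complexI; rewrite rmorphM /= -!normE_rnorm normrZ. Qed.

Lemma sqr_rnormDZ x (a : R[i]) v :
  rnorm (x + a *: v) ^+ 2 =
  rnorm x ^+ 2 + 2 * complex.Re (a * dot v x) + rnorm a ^+ 2 * rnorm v ^+ 2.
Proof.
rewrite -exprMn -rnormZ; apply: complexI; rewrite -dotxx.
rewrite linearDl !linearDr /= (dotC x (a *: v)) !linearZl_LR /= 2!rmorphD /= -!dotxx.
set b := a * _.
rewrite !linearZl_LR /=.
have -> : (2 * complex.Re b)%:C = b + Num.conj b.
  by case: b => p q; apply/eqP; rewrite eq_complex /= subrr mulrDl mul1r !eqxx.
ring.
Qed.

Lemma Cauchy_Schwarz x y : rnorm (dot x y) <= rnorm x * rnorm y.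
Proof.
rewrite -(@ler_pXn2r _ 2) ?nnegrE ?mulr_ge0 ?rnorm_ge0//.
rewrite exprMn mulrC; apply: sqr_rnorm_le_of_quadratic; first exact: sqr_ge0.
move=> a; have := sqr_rnormDZ y (- a) x.
have := sqr_ge0 (rnorm (y + - a *: x)).
rewrite rnormN mulNr raddfN /=; lra.
Qed.

(** If [x] minimizes [Q x = |x|^2 - 2 Re (l x)] up to [e^2], then comparing
    [Q x] with [Q (x + a v)] for all scalars [a] bounds the linear
    term [l v - <v, x>] of the difference by [e |v|]. *)
Lemma Riesz_representation_approx (l : H -> R[i]) (M : R) (e : R) :
  scalar l -> (forall x, rnorm (l x) <= M * rnorm x) -> 0 < e ->
  exists x, forall v, rnorm (l v - dot v x) <= e * rnorm v.
Proof.
move=> l_lin l_bnd e0.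
pose Q x : R := rnorm x ^+ 2 - 2 * complex.Re (l x).
have Q_lb x : - M ^+ 2 <= Q x.
  have := le_trans (Re_le_rnorm (l x)) (l_bnd x).
  have := sqr_ge0 (rnorm x - M); rewrite /Q; lra.
have Q_inf : has_inf (range Q).
  split; first by exists (Q 0); exists 0.
  by exists (- M ^+ 2) => _ [x _ <-].
have [_ [x _ <-] Qx] := inf_adherent (exprn_gt0 2 e0) Q_inf.
exists x => v.
rewrite -(@ler_pXn2r _ 2) ?nnegrE ?mulr_ge0 ?rnorm_ge0 ?(ltW e0)// exprMn.
apply: sqr_rnorm_le_of_quadratic; first exact: sqr_ge0.
move=> a.
have Q_min : inf (range Q) <= Q (x + a *: v).
  by apply: ge_inf; [case: Q_inf | exists (x + a *: v)].
move: Q_min Qx.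
rewrite /Q sqr_rnormDZ [x + _]addrC l_lin mulrBr raddfB raddfD /=; lra.
Qed.

(** Representatives of [l] up to [1 / (n + 1)] form a Cauchy sequence, since two
    vectors [x], [y] representing [l] up to [e] and [e'] satisfy
    [|x - y|^2 = <d, x - y> <= (e + e') |d|] with [d = x - y]. *)
Lemma Riesz_representation (l : H -> R[i]) (M : R) :
  scalar l -> (forall x, rnorm (l x) <= M * rnorm x) ->
  exists z, forall x, l x = dot x z.
Proof.
move=> l_lin l_bnd.
have /choice[u uP] (n : nat) : exists x, forall v,
    rnorm (l v - dot v x) <= n.+1%:R^-1 * rnorm v.
  by apply: Riesz_representation_approx l_lin l_bnd _; rewrite invr_gt0.
have u_dist m n : rnorm (u m - u n) <= m.+1%:R^-1 + n.+1%:R^-1.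
  set d := u m - u n.
  have [->|d_neq0] := eqVneq (rnorm d) 0; first by rewrite addr_ge0 ?invr_ge0.
  have d_gt0 : 0 < rnorm d by rewrite lt_def d_neq0 rnorm_ge0.
  rewrite -(ler_pM2r d_gt0) -expr2.
  have -> : rnorm d ^+ 2 = rnorm (dot d d).
    by rewrite dotxx rnorm_real ger0_norm // sqr_ge0.
  have -> : dot d d = (l d - dot d (u n)) + - (l d - dot d (u m)).
    by rewrite {2}/d linearBr; ring.
  rewrite (le_trans (rnormD _ _))// rnormN mulrDl addrC.
  by rewrite lerD // uP.
have u_cvg : cvg (u @ \oo).
  apply/cauchy_cvgP/cauchy_exP => e e0.
  have eE : e = (complex.Re e)%:C by rewrite RRe_real // gtr0_real.
  have e'0 : 0 < complex.Re e / 2 by rewrite divr_gt0 // -ltcR -eE.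
  have [N _ NP] := near_infty_natSinv_lt (PosNum e'0).
  exists (u N); exists N => // n /= Nn.
  rewrite -ball_normE /= normE_rnorm eE ltcR.
  rewrite (le_lt_trans (u_dist _ _))// (splitr (complex.Re e)).
  by rewrite ltrD // NP //=.
exists (lim (u @ \oo)) => v.
apply/subr0_eq/rnorm_eq0/le_anti; rewrite rnorm_ge0 andbT.
apply/ler_addgt0Pr => e e0; rewrite add0r.
(* An index with both 1 / (n + 1) and |z - u n| below d gives the error e;
   the summand 1 keeps the denominator nonzero when v = 0. *)
pose d := e / 2 / (rnorm v + 1).
have v1 : 0 < rnorm v + 1 by rewrite ltr_wpDl ?rnorm_ge0.
have d0 : 0 < d by rewrite !divr_gt0.
have dC0 : 0 < d%:C by rewrite ltcR.
have [N1 _ N1P] := near_infty_natSinv_lt (PosNum d0).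
have [N2 _ N2P] := iffLR (cvgrPdist_lt _ _) u_cvg _ dC0.
pose n := maxn N1 N2.
have h1 := N1P n (leq_maxl _ _).
have := N2P n (leq_maxr _ _); rewrite /= normE_rnorm ltcR => h2.
set z := lim _ in h2 *.
have -> : l v - dot v z = (l v - dot v (u n)) + - dot v (z - u n).
  by rewrite linearBr; ring.
rewrite (le_trans (rnormD _ _))// rnormN.
rewrite (le_trans (lerD (uP n v) (Cauchy_Schwarz v (z - u n)))) //.
have -> : e = d * (rnorm v + 1) + (rnorm v + 1) * d.
  by rewrite /d; field; rewrite gt_eqF.
have := rnorm_ge0 v; have := rnorm_ge0 (z - u n).
move: h1 => /= h1 ? ?.
by rewrite lerD // ler_pM ?invr_ge0 ?rnorm_ge0 ?lerDl // ltW.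
Qed.

Lemma adjointP T : bounded_operator T ->
  forall x y, dot (T x) y = dot x (adjoint dot T y).
Proof.
move=> [M TM] x y; rewrite /adjoint.
case: xgetP => [z _ zP|noz]; first exact: zP.
exfalso; have [z zP] : exists z, forall v, dot (T v) y = dot v z.
  apply: (@Riesz_representation (fun v => dot (T v) y) (M * rnorm y)) => [a u v|v].
    by rewrite linearP linearDl linearZl_LR.
  rewrite (le_trans (Cauchy_Schwarz _ _))// mulrAC.
  by rewrite ler_wpM2r ?rnorm_ge0.
exact: noz z zP.
Qed.

Lemma Riesz_frame_member_ge (I : countType) (e : I -> H) (C1 C2 : R) (i : I) :
  frame_sequence_with_bounds dot e [set i] C1 C2 ->
  e i = 0 \/ C1 <= rnorm (e i) ^+ 2.
Proof.
move=> [_ bounds].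
have [|lower _] := bounds (e i).
  apply: subset_closure; exists 1%N, (fun=> 1), (fun=> e i).
  by split=> [_|]; [exists i | rewrite big_ord1 scale1r].
have [/rnorm_eq0|ei_neq0] := eqVneq (rnorm (e i)) 0; first by left.
right; move: lower; rewrite esum_set1 ?lee_fin ?sqr_ge0 //.
rewrite dotxx rnorm_real ger0_norm ?sqr_ge0// expr2 ler_pM2r //.
by rewrite lt_def sqrf_eq0 ei_neq0 sqr_ge0.
Qed.

End Hilbert.

(** * Orbits of a normal operator *)

Section NormalOrbits.
Context {R : realType} {H : completeNormedModType R[i]}.
Context (dot : {dot H for Num.conj}) (dot_norm : dot_induces_norm dot).
Context (T : {linear H -> H}) (T_bounded : bounded_operator T).
Context (T_normal : normal_operator dot T).
Implicit Types (x y : H).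

Let dotT := adjointP dot_norm T_bounded.

Lemma dot_adjointl x y : dot (adjoint dot T x) y = dot x (T y).
Proof. by rewrite dotC -dotT -dotC. Qed.

Lemma dot_iter_adjointl m x y :
  dot (iter m (adjoint dot T) x) y = dot x (iter m T y).
Proof. by elim: m y => //= m IH y; rewrite dot_adjointl IH -iterSr. Qed.

(** Normality enters in the middle of
    [<T x, T x> = <x, T^* T x> = <x, T T^* x> = <T^* x, T^* x>]. *)
Lemma rnorm_adjoint x : rnorm (T x) = rnorm (adjoint dot T x).
Proof.
apply/eqP; rewrite -(@eqrXn2 _ 2) ?rnorm_ge0//; apply/eqP/complexI.
by rewrite -!(dotxx dot_norm) dotT -T_normal dot_adjointl.
Qed.

Lemma rnorm_iter_adjoint m x :
  rnorm (iter m T x) = rnorm (iter m (adjoint dot T) x).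
Proof.
elim: m x => // m IH x; rewrite [in RHS]iterSr -IH /= rnorm_adjoint.
(* The adjoint commutes with T, hence with its powers. *)
by congr rnorm; elim: m {IH} => //= m <-; rewrite T_normal.
Qed.

(** If [T (T y) = 0] then [|T^* (T y)| = |T (T y)| = 0], so that
    [|T y|^2 = <y, T^* (T y)> = 0]: one power of [T] can be removed at a time. *)
Lemma iter_eq0 m x : iter m T x = 0 -> T x = 0.
Proof.
case: m => [/= ->|]; first exact: linear0.
elim=> //= m IH TTx0; apply: IH.
have: dot (iter m.+1 T x) (iter m.+1 T x) = 0.
  rewrite /= dotT.
  have -> : adjoint dot T (T (iter m T x)) = 0.
    by apply: rnorm_eq0; rewrite -rnorm_adjoint TTx0 /rnorm normr0.
  by rewrite linear0r.
by rewrite dotxx // => /complexI/eqP; rewrite sqrf_eq0 => /eqP/rnorm_eq0.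
Qed.

(** The coefficients of [(T^* )^m f] against the orbit of [phi] are those of [f]
    with the first [m] dropped. *)
Lemma frame_orbit_small (phi : H) :
  is_frame dot (fun n => iter n T phi) ->
  forall (f : H) (e : R), 0 < e -> exists m, rnorm (iter m T f) ^+ 2 < e.
Proof.
move=> [C1 [C2 [/andP[C1_gt0 _] bounds]]] f e e_gt0.
pose a n : \bar R := (rnorm (dot f (iter n T phi)) ^+ 2)%:E.
have a_ge0 n : (0 <= a n)%E by rewrite lee_fin sqr_ge0.
have a_sum : (\sum_(0 <= n <oo) a n < +oo)%E.
  by rewrite nneseries_esumT // (le_lt_trans (bounds f I).2) ?ltry.
have Ce_gt0 : 0 < C1 * e by rewrite mulr_gt0.
have Ce_nbhs : nbhs 0%E [set x : \bar R | (x < (C1 * e)%:E)%E].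
  by apply: open_nbhs_nbhs; split; [exact: open_ereal_lt_ereal|rewrite /= lte_fin].
have [m _ /(_ m (leqnn m)) /= tail_small] :=
  nneseries_tail_cvg a_sum (fun n _ => a_ge0 n) Ce_nbhs.
exists m.
rewrite -(ltr_pM2l C1_gt0) -lte_fin rnorm_iter_adjoint.
rewrite (le_lt_trans (bounds _ I).1) //.
rewrite -nneseries_esumT; last by move=> n; rewrite lee_fin sqr_ge0.
rewrite (eq_eseriesr (g := fun n => a (n + m)%N)); last first.
  by move=> n _; rewrite dot_iter_adjointl -iterD addnC.
by rewrite nneseries_addn.
Qed.

(** What remains of [f] after projection onto [phi] is orthogonal to every
    member of the frame, so the lower frame inequality makes it zero. *)
Lemma frame_orbit_ker (phi : H) :
  is_frame dot (fun n => iter n T phi) -> T phi = 0 ->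
  linear_span [set phi] = [set: H].
Proof.
move=> [C1 [C2 [/andP[C1_gt0 _] bounds]]] Tphi0.
have iter0 n : iter n.+1 T phi = 0.
  by elim: n => //= n ->; rewrite linear0.
apply/seteqP; split=> // f _.
(* If phi = 0 the quotient is 0, which is still a correct coefficient. *)
pose c := dot f phi / dot phi phi; pose g := f - c *: phi.
have g_perp : dot g phi = 0.
  rewrite linearBl linearZl_LR /=.
  have [phi0|phi_neq0] := eqVneq (dot phi phi) 0.
    have phi_eq0 : phi = 0.
      move: phi0; rewrite dotxx // => /complexI/eqP.
      by rewrite sqrf_eq0 => /eqP/rnorm_eq0.
    by rewrite phi0 mulr0 phi_eq0 linear0r subrr.
  by rewrite divfK ?subrr.
have g0 : g = 0.
  have [lb _] := bounds g I.
  move: lb; rewrite esum1 => [|[|n] _].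
  - rewrite lee_fin pmulr_rle0 // => g2.
    apply/rnorm_eq0/eqP; rewrite -sqrf_eq0; apply/eqP/le_anti.
    by rewrite g2 sqr_ge0.
  - by rewrite /= g_perp /rnorm normr0 expr0n.
  - by rewrite iter0 linear0r /rnorm normr0 expr0n.
exists 1%N, (fun=> c), (fun=> phi); split=> //.
by rewrite big_ord1; apply/subr0_eq.
Qed.

End NormalOrbits.

Unset Implicit Arguments.
Set Strict Implicit.

Theorem corollary30 (R : realType) (H : completeNormedModType R[i])
    (dot : {dot H for Num.conj})
    (dot_norm : dot_induces_norm dot)
    (sepH : separable H)
    (infH : infinite_dimensional H)
    (T : {linear H -> H})
    (T_bounded : bounded_operator T)
    (T_normal : normal_operator dot T)
    (phi : H)
    (T_frame : is_frame dot (fun n : nat => iter n T phi)) :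
  ~ is_Riesz_frame dot (fun n : nat => iter n T phi).
Proof.
move=> [_ [C1 [C2 [/andP[C1_gt0 _] subframes]]]].
have [m m_small] :=
  frame_orbit_small dot_norm T_bounded T_normal T_frame phi C1_gt0.
have [Tm0|] := Riesz_frame_member_ge dot_norm (subframes [set m]); last first.
  by rewrite leNgt m_small.
apply: infH; exists [set phi]; first exact: finite_set1.
apply: (frame_orbit_ker dot_norm T_frame).
exact: (iter_eq0 dot_norm T_bounded T_normal Tm0).
Qed.
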